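(* The kernel of the pairing $\langle\cdot,\cdot\rangle$ on $\mathbf{H}_o$, namely $\{x\in\mathbf{H}_o:\langle x,y\rangle=0\ \forall y\in\mathbf{H}_o\}$, is $Ker(\Theta)$. Moreover, the restriction of the pairing to $\mathbf{H}_{ho}$ is non-degenerate.
   Context: $K$ is a commutative field. A rooted forest is a finite graph $F$ whose connected components are rooted trees; $V(F)$ is its vertex set. Edges are oriented from leaves to roots, and $v\twoheadrightarrow w$ means there is an oriented path from $v$ to $w$ (with $v\twoheadrightarrow v$). An ordered forest is a rooted forest with a total order on its vertices (up to isomorphism); if it has $n$ vertices, its vertex set is identified with $\{1,\ldots,n\}$ via the unique increasing bijection. It is heap-ordered if $i\twoheadrightarrow j$ with $i\neq j$ implies $i>j$. $\mathbf{H}_o$ is the $K$-vector space with basis the ordered forests and $\mathbf{H}_{ho}$ is its subspace spanned by heap-ordered forests. The pairing on $\mathbf{H}_o$ is the bilinear form with $\langle F,G\rangle=|S(F,G)|$ for ordered forests $F,G$, where $S(F,G)$ is the set of bijections $f:V(F)\to V(G)$ such that for all $x,y\in V(F)$: $x\twoheadrightarrow y$ in $F$ implies $f(x)\ge f(y)$, and $f(x)\twoheadrightarrow f(y)$ in $G$ implies $x\ge y$. $\mathbf{FQSym}$ is the $K$-vector space with basis $\bigsqcup_{n\ge0}\mathfrak{S}_n$. For an ordered forest $F$ with $n$ vertices, $S_F$ is the set of $\sigma\in\mathfrak{S}_n$ such that for all $1\le i,j\le n$, $i\twoheadrightarrow j$ in $F$ implies $\sigma^{-1}(i)\ge\sigma^{-1}(j)$.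 $\Theta:\mathbf{H}_o\to\mathbf{FQSym}$ is the linear map with $\Theta(F)=\sum_{\sigma\in S_F}\sigma$. *)

(* Defs.v *)
From HB Require Import structures.
From mathcomp Require Import all_boot all_order all_algebra all_fingroup.
From mathcomp Require Import finmap.
From mathcomp.multinomials Require Import monalg.

Set Implicit Arguments.
Unset Strict Implicit.
Unset Printing Implicit Defensive.

Import GRing.Theory.
Local Open Scope ring_scope.

(* A rooted forest with vertex set 'I_n is given by its parent map: the edges
   are x -> y with p x = Some y, i.e. oriented towards the roots, which are the
   vertices with p x = None.  The absence of oriented cycles is exactly what
   makes every connected component of this graph a tree with a unique root. *)
Section OrderedForests.
Variable n : nat.

Definition pedge (p : {ffun 'I_n -> option 'I_n}) : rel 'I_n :=
  [rel x y | p x == Some y].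

Definition acyclic_parent (p : {ffun 'I_n -> option 'I_n}) : bool :=
  [forall x, forall y, pedge p x y ==> ~~ connect (pedge p) y x].

(* The total order on the vertices is the order of 'I_n; each isomorphism class
   of ordered forests has exactly one representative of this form (vertices are
   numbered from 0 instead of 1). *)
Definition oforest_of := {p : {ffun 'I_n -> option 'I_n} | acyclic_parent p}.

(* reach F v w is v ->> w; in particular reach F v v. *)
Definition reach (F : oforest_of) : rel 'I_n := connect (pedge (val F)).

Definition heap_ordered_of (F : oforest_of) : bool :=
  [forall i : 'I_n, forall j : 'I_n,
    reach F i j && (i != j) ==> (j < i)%N].

Definition S_ (F : oforest_of) : {set 'S_n} :=
  [set s : 'S_n | [forall i, forall j,
     reach F i j ==> ((s^-1)%g j <= (s^-1)%g i)%N]].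

End OrderedForests.

Definition oforest := {n : nat & oforest_of n}.
Definition permutation := {n : nat & 'S_n}.

Definition heap_ordered (F : oforest) : bool := heap_ordered_of (tagged F).

Definition bij_ffun (m n : nat) (f : {ffun 'I_m -> 'I_n}) : bool :=
  injectiveb f && [forall y, y \in codom f].

Lemma bij_ffunP (m n : nat) (f : {ffun 'I_m -> 'I_n}) :
  reflect (bijective f) (bij_ffun f).
Proof.
apply: (iffP andP) => [[/injectiveP fI /forallP fS]|fB].
  apply: inj_card_bij fI _; rewrite -(size_codom f) cardT.
  by apply: uniq_leq_size (enum_uniq _) _ => y _; apply: fS.
split; first by apply/injectiveP; apply: bij_inj.
by case: fB => g _ gK; apply/forallP => y; apply/codomP; exists (g y).
Qed.

Definition Spair (F G : oforest) : {set {ffun 'I_(tag F) -> 'I_(tag G)}} :=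
  [set f | bij_ffun f &
     [forall x, forall y,
        (reach (tagged F) x y ==> (f y <= f x)%N) &&
        (reach (tagged G) (f x) (f y) ==> (y <= x)%N)]].

Notation Ho K := {malg K[oforest]}.
Notation FQSym K := {malg K[permutation]}.

Section LinearExtension.
Variables (K : fieldType) (I : choiceType) (V : lmodType K).

Definition linext (f : I -> V) (x : {malg K[I]}) : V :=
  \sum_(k <- msupp x) x@_k *: f k.

Lemma linextEw (f : I -> V) (x : {malg K[I]}) (d : {fset I}) :
  {subset msupp x <= d} -> linext f x = \sum_(k <- d) x@_k *: f k.
Proof.
move=> sxd; apply: big_fset_incl; first by apply/fsubsetP.
by move=> k _ /mcoeff_outdom ->; rewrite scale0r.
Qed.

Lemma linext_is_linear (f : I -> V) : linear (linext f).
Proof.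
move=> a x y.
pose d := (msupp x `|` msupp y `|` msupp (a *: x + y)%R)%fset.
rewrite !(@linextEw f _ d); try by
  move=> k kx; rewrite /d !inE kx ?orbT.
rewrite scaler_sumr -big_split /=; apply: eq_bigr => k _.
by rewrite mcoeffD mcoeffZ scalerDl scalerA.
Qed.

HB.instance Definition _ (f : I -> V) :=
  GRing.isLinear.Build K {malg K[I]} V *:%R (linext f) (linext_is_linear f).

Lemma linextU (f : I -> V) (i : I) : linext f << i >> = f i.
Proof.
rewrite (@linextEw f _ [fset i]%fset) ?big_seq_fset1 ?mcoeffUU ?scale1r //.
exact/fsubsetP/msuppU_le.
Qed.

End LinearExtension.

Section Maps.
Variable K : fieldType.

Definition Theta : Ho K -> FQSym K :=
  linext (fun F : oforest =>
    \sum_(s in S_ (tagged F)) << (Tagged (fun n => 'S_n) s : permutation) >>).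

Definition pairing (x y : Ho K) : K :=
  linext (fun F => linext (fun G => #|Spair F G|%:R : K^o) y : K^o) x.

Lemma ThetaU (F : oforest) :
  Theta << F >> = \sum_(s in S_ (tagged F)) << (Tagged (fun n => 'S_n) s : permutation) >>.
Proof. exact: linextU. Qed.

Lemma pairingU (F G : oforest) : pairing << F >> << G >> = #|Spair F G|%:R.
Proof. by rewrite /pairing !linextU. Qed.

Lemma pairing_linearl (y : Ho K) : linear (pairing^~ y : Ho K -> K^o).
Proof. exact: linext_is_linear. Qed.

Lemma pairing_linearr (x : Ho K) : linear (pairing x : Ho K -> K^o).
Proof.
move=> a y z; rewrite /pairing {1 3 5}/linext scaler_sumr -big_split /=.
apply: eq_bigr => F _.
pose g G : K^o := #|Spair F G|%:R.
have -> : linext g (a *: y + z) = a *: linext g y + linext g z.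
  exact: linext_is_linear.
by rewrite scalerDr !scalerA mulrC.
Qed.

Definition in_Hho (x : Ho K) : Prop :=
  exists (s : seq oforest) (c : oforest -> K),
    all heap_ordered s /\ x = \sum_(F <- s) c F *: << F >>.

End Maps.

Definition nondegenerate_on (K : fieldType) (V : lmodType K)
    (W : V -> Prop) (b : V -> V -> K) : Prop :=
  (forall x, W x -> (forall y, W y -> b x y = 0) -> x = 0) /\
  (forall y, W y -> (forall x, W x -> b x y = 0) -> y = 0).

(* Main.v *)
(* A bijection f lies in S(F, G) iff f is in S_G and f^-1 is in S_F, hence
   <x, G> is the sum over t in S_G of the coefficient of t^-1 in Theta(x), and
   Ker(Theta) lies in the kernel.  The converse and the non-degeneracy on H_ho
   come from a unitriangularity that holds over any field.  View s as the word
   s(1)...s(n) and let F_s be the heap-ordered forest in which the parent of i is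
   the nearest letter to the left of i that is smaller than i.  If t is in S_(F_s)
   and i is the least letter for which the letters a < i preceding i differ in s
   and t, then every such a in s precedes the parent of i or equals it, so it also
   precedes i in t.  Thus s is the minimum of S_(F_s) for the lexicographic order
   on the codes (number of a < i preceding i)_i.  In particular s |-> F_s is
   injective, and it reaches all heap-ordered forests because there
   are at most n! of them: i has i - 1 possible parents, or none. *)
Require Import Defs.
From mathcomp Require Import all_boot all_order all_algebra all_fingroup.
From mathcomp Require Import finmap.
From mathcomp.multinomials Require Import monalg.

Set Implicit Arguments.
Unset Strict Implicit.
Unset Printing Implicit Defensive.

Import Order.TTheory GRing.Theory.
Local Open Scope ring_scope.

(** * Path conditions reduced to parent edges, and a count of heap-ordered forests *)

Lemma pedge_connect_leq n (p : {ffun 'I_n -> option 'I_n}) (h : 'I_n -> nat) :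
    (forall i j, p i = Some j -> (h j <= h i)%N) ->
  forall x y, connect (pedge p) x y -> (h y <= h x)%N.
Proof.
move=> ph x y /connectP[q]; elim: q x => [|z q IHq] x /= => [_ -> //|].
by case/andP=> /eqP/ph hzx qP yE; apply: leq_trans (IHq _ qP yE) hzx.
Qed.

Lemma decreasing_acyclic n (p : {ffun 'I_n -> option 'I_n}) :
  (forall i j, p i = Some j -> (j < i)%N) -> acyclic_parent p.
Proof.
move=> ltp; apply/forallP=> x; apply/forallP=> y; apply/implyP=> /eqP/ltp ltyx.
apply/negP=> /(@pedge_connect_leq _ _ val).
by rewrite leqNgt ltyx => /(_ (fun i j e => ltnW (ltp i j e))).
Qed.

Lemma heap_ordered_ofP n (F : oforest_of n) :
  reflect (forall i j, val F i = Some j -> (j < i)%N) (heap_ordered_of F).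
Proof.
apply: (iffP forallP) => [hoF i j pij | ltF i].
  have /forallP/(_ j)/implyP := hoF i; apply; apply/andP; split.
    by apply: connect1; apply/eqP.
  (* A vertex that is its own parent would be an oriented cycle. *)
  apply: contraPneq (valP F) => eij; apply/negP/forallPn; exists i.
  by rewrite -eij in pij; apply/forallPn; exists i; rewrite /pedge /= pij eqxx connect0.
apply/forallP=> j; apply/implyP=> /andP[rij neij].
rewrite ltn_neqAle (inj_eq val_inj) eq_sym neij.
by apply: pedge_connect_leq rij => a b /ltF/ltnW.
Qed.

Lemma S_P n (F : oforest_of n) (s : 'S_n) :
  reflect (forall i j, val F i = Some j -> (s^-1%g j <= s^-1%g i)%N) (s \in S_ F).
Proof.
rewrite inE; apply: (iffP forallP) => [sF i j pij | sF i].
  by have /forallP/(_ j)/implyP := sF i; apply; apply: connect1; apply/eqP.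
apply/forallP=> j; apply/implyP; apply: (@pedge_connect_leq _ _ (fun a => s^-1%g a)).
exact: sF.
Qed.

Lemma card_ord_ltn n k : (k <= n)%N -> #|[set i : 'I_n | (i < k)%N]| = k.
Proof.
by move=> lekn; rewrite cardsE -sum1_card (big_ord_narrow lekn) sum1_card card_ord.
Qed.

(** Vertices are numbered from 0, so [i] has [i] smaller vertices and, with [None], at most [i.+1]
    choices of parent; the product of these numbers is [n]!. *)
Lemma leq_card_heap_ordered n :
  (#|[set F : oforest_of n | heap_ordered_of F]| <= n`!)%N.
Proof.
pose B (i : 'I_n) : {set option 'I_n} := None |: (some @: [set j : 'I_n | (j < i)%N]).
have cardB i : #|B i| = i.+1.
  rewrite cardsU1 card_imset; last by move=> ? ? [].
  by rewrite (card_ord_ltn (ltnW (ltn_ord i))); case: imsetP => // -[].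
have -> : n`! = #|family (fun i => mem (B i))|.
  rewrite card_family fact_prod big_add1 /= big_mkord foldrE big_image /=.
  by apply: eq_bigr => i _; rewrite cardB.
rewrite -(card_imset _ (val_inj : injective (val : oforest_of n -> _))).
apply/subset_leq_card/subsetP=> p /imsetP[F]; rewrite inE => /heap_ordered_ofP ltF ->.
apply/familyP=> i; rewrite !inE; case pi: (val F i) => [j|] //.
by rewrite imset_f // inE ltF.
Qed.

(** * Forests of nearest smaller letters and the order on codes *)

Section MinimalForest.
Variable n : nat.
Implicit Types (s t : 'S_n) (i j : 'I_n).

(** [s^-1 a] is the position of the letter [a] in the word of [s]. *)
Definition before s i : {set 'I_n} :=
  [set a : 'I_n | (a < i)%N && (s^-1%g a < s^-1%g i)%N].

Definition before_code s : n.-tuplelexi nat := [tuple #|before s i| | i < n].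

(** The nearest letter on the left is the one of greatest position. Positions are distinct, so
    [pick] has at most one candidate; it has none exactly when [before s i] is empty, and then [i]
    is a root. *)
Definition left_parent s : {ffun 'I_n -> option 'I_n} :=
  [ffun i => [pick j in before s i |
     [forall a in before s i, (s^-1%g a <= s^-1%g j)%N]]].

Lemma left_parentP s i : pick_spec
  (fun j => (j \in before s i) && [forall a in before s i, (s^-1%g a <= s^-1%g j)%N])
  (left_parent s i).
Proof. by rewrite ffunE; case: pickP => [x|] H; constructor. Qed.

Lemma left_parent_lt s i j :
  left_parent s i = Some j -> (j < i)%N && (s^-1%g j < s^-1%g i)%N.
Proof. by case: left_parentP => // k /andP[+ _] [<-]; rewrite inE. Qed.

Lemma left_parent_acyclic s : acyclic_parent (left_parent s).
Proof. by apply: decreasing_acyclic => i j /left_parent_lt/andP[]. Qed.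

Definition left_forest s : oforest_of n :=
  exist (fun p => acyclic_parent p) (left_parent s) (left_parent_acyclic s).

Lemma left_forest_heap s : heap_ordered_of (left_forest s).
Proof. by apply/heap_ordered_ofP=> i j /left_parent_lt/andP[]. Qed.

Lemma left_forest_self s : s \in S_ (left_forest s).
Proof. by apply/S_P=> i j /left_parent_lt/andP[_ /ltnW]. Qed.

Lemma left_parent_ge s i a : a \in before s i ->
  exists2 j, left_parent s i = Some j & (s^-1%g a <= s^-1%g j)%N.
Proof.
case: left_parentP => [j /andP[_ /forallP jmax] | nomax] ai.
  by exists j => //; apply: implyP (jmax a) ai.
case: (arg_maxnP (fun b => s^-1%g b : nat) ai) => j ji jmax.
have := nomax j; rewrite (ji : j \in before s i) => /forallP[] b.
by apply/implyP=> /jmax.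
Qed.

Lemma perm_ltnNge s i j : i != j -> (s i < s j)%N = ~~ (s j < s i)%N.
Proof. by case: ltngtP => // /val_inj/perm_inj->; rewrite eqxx. Qed.

(** The relative position of two letters is recorded in the [before] set of the larger one. *)
Lemma before_agree s t (k : nat) :
    (forall i, (i < k)%N -> before s i = before t i) ->
  forall a b : 'I_n, (a < k)%N -> (b < k)%N ->
    (s^-1%g a < s^-1%g b)%N = (t^-1%g a < t^-1%g b)%N.
Proof.
move=> eqst.
have lt_agree (a b : 'I_n) : (b < k)%N -> (a < b)%N ->
    (s^-1%g a < s^-1%g b)%N = (t^-1%g a < t^-1%g b)%N.
  by move=> ltbk ltab; move/setP/(_ a): (eqst b ltbk); rewrite !inE ltab.
move=> a b ltak ltbk; case: (ltngtP a b) => [|ltba|/val_inj->].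
- exact: lt_agree.
- have nab : a != b by apply: contraTneq ltba => ->; rewrite ltnn.
  by rewrite !(perm_ltnNge _ nab) lt_agree.
- by rewrite !ltnn.
Qed.

Lemma before_inj s t : before s =1 before t -> s = t.
Proof.
move=> eqst; apply: invg_inj; apply/permP=> i; apply: val_inj => /=.
(* Positions start at 0, so the position of a letter is the number of letters to its left. *)
have card_inv (u : 'S_n) : (u^-1%g i : nat) = #|[set a | u^-1%g a < u^-1%g i]|%N.
  rewrite -(card_imset _ (@perm_inj _ u^-1%g)).
  rewrite -[LHS](@card_ord_ltn n) ?(ltnW (ltn_ord _)) //.
  apply: eq_card => b; rewrite inE; apply/idP/imsetP => [ltb|[a + ->]].
    by exists (u b); rewrite ?inE permK.
  by rewrite inE.
rewrite (card_inv s) (card_inv t); apply: eq_card => a; rewrite !inE.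
by apply: (@before_agree s t n) => // b _; apply: eqst.
Qed.

Lemma left_forest_min s t :
  t \in S_ (left_forest s) -> t != s -> (before_code s < before_code t)%O.
Proof.
move=> /S_P tFs neq_ts.
have [i0 nei0] : exists i, before s i != before t i.
  apply/existsP; apply: contraR neq_ts => /existsPn eqst.
  by apply/eqP/esym/before_inj => i; apply/eqP; rewrite -[_ == _]negbK eqst.
case: (@arg_minnP _ i0 (fun i => before s i != before t i) val nei0) => k nek kmin.
have eqst i : (i < k)%N -> before s i = before t i.
  by move=> ltik; apply/eqP; apply: contraLR ltik => /kmin; rewrite -leqNgt.
(* The codes agree below [k]; at [k] it suffices that [before s k] is strictly contained in
   [before t k]. *)
apply/ltxi_tuplePlt; exists k => [i /eqst eqi|]; rewrite !tnth_mktuple ?eqi //.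
apply: proper_card; rewrite properEneq nek; apply/subsetP=> a ak.
have [j pj leaj] := left_parent_ge ak.
move: ak; rewrite !inE => /andP[ltak _]; rewrite ltak /=.
have [ltjk _] := andP (left_parent_lt pj).
have /(_ k j pj) lejk := tFs.
have njk : j != k by apply: contraTneq ltjk => ->; rewrite ltnn.
have ltjk' : (t^-1%g j < t^-1%g k)%N by rewrite perm_ltnNge // -leqNgt.
(* Both [a] and the parent [j] are smaller than [k], so their relative position is the same in [s]
   and [t]. *)
apply: leq_ltn_trans ltjk'; rewrite leqNgt -(before_agree eqst) //.
by rewrite -leqNgt.
Qed.

(** If two distinct permutations had the same forest, each would have a smaller code than the
    other. *)
Lemma left_forest_inj : injective left_forest.
Proof.
move=> s t eqF; apply/eqP; apply: contraT => nest.
have := left_forest_min (s := s) (t := t); rewrite {1}eqF left_forest_self eq_sym.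
move=> /(_ isT nest) lt_st.
have := left_forest_min (s := t) (t := s); rewrite -{1}eqF left_forest_self.
by move=> /(_ isT nest)/(lt_trans lt_st); rewrite ltxx.
Qed.

Lemma left_forest_surj F : heap_ordered_of F -> exists s, F = left_forest s.
Proof.
move=> hoF; pose H := [set F : oforest_of n | heap_ordered_of F].
have subH : [set left_forest s | s in [set: 'S_n]] \subset H.
  by apply/subsetP=> _ /imsetP[s _ ->]; rewrite inE left_forest_heap.
have : F \in H by rewrite inE.
have /eqP<- : [set left_forest s | s in [set: 'S_n]] == H.
  rewrite eqEcard subH (card_imset _ left_forest_inj) cardsT card_Sn.
  exact: leq_card_heap_ordered.
by case/imsetP=> s _ ->; exists s.
Qed.

End MinimalForest.

(** * The sets S(F, G) in terms of permutations *)

Section SpairCard.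
Implicit Types (n : nat) (F G : oforest).

Lemma card_Spair n (F G : oforest_of n) :
  #|Spair (Tagged oforest_of F) (Tagged oforest_of G)|
    = #|[set t in S_ G | (t^-1)%g \in S_ F]|.
Proof.
rewrite -(card_imset _ (val_inj : injective (val : 'S_n -> _))).
apply: eq_card => f; apply/idP/imsetP.
  rewrite inE => /andP[/andP[fI _] /forallP fFG].
  have fE (i : 'I_n) : Perm fI i = f i by rewrite -pvalE.
  exists (Perm fI) => //; rewrite !inE; apply/andP; split.
    apply/forallP=> i; apply/forallP=> j.
    (* The condition on G is taken at the preimages of [i] and [j]. *)
    have /forallP/(_ ((Perm fI)^-1%g j))/andP[_] := fFG ((Perm fI)^-1%g i).
    by rewrite -!fE /= !permKV.
  apply/forallP=> i; apply/forallP=> j; rewrite invgK !fE.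
  by have /forallP/(_ j)/andP[] := fFG i.
case=> t; rewrite !inE invgK => /andP[/forallP tG /forallP tF] ->.
have tE (i : 'I_n) : val t i = t i by rewrite -pvalE.
apply/andP; split.
  apply/bij_ffunP; exists (t^-1)%g => i; rewrite tE ?permK //.
  by rewrite permKV.
apply/forallP=> i; apply/forallP=> j; rewrite !tE.
have /forallP/(_ j)-> /= := tF i.
by have /forallP/(_ (t j)) := tG (t i); rewrite !permK.
Qed.

Lemma Spair_neq F G : tag F != tag G -> Spair F G = set0.
Proof.
apply: contra_neq_eq => /set0Pn[f]; rewrite inE => /andP[/bij_ffunP/bij_eq_card].
by rewrite !card_ord.
Qed.

(** For equal sizes, inversion exchanges the two membership conditions of [card_Spair]; otherwise
    both sets are empty. *)
Lemma card_Spair_sym F G : #|Spair F G| = #|Spair G F|.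
Proof.
have [eqFG|neFG] := eqVneq (tag F) (tag G); last first.
  by rewrite (Spair_neq neFG) Spair_neq ?cards0 1?eq_sym.
case: F G eqFG => [n F] [m G] /= eqnm; case: _ / eqnm G => G.
rewrite !card_Spair -(card_imset _ (@invg_inj _)).
apply: eq_card => t; rewrite inE; apply/imsetP/andP => [[u]|[tF tG]].
  by rewrite inE => /andP[uG uF] ->; rewrite invgK.
by exists (t^-1)%g; [rewrite inE invgK tG | rewrite invgK].
Qed.

End SpairCard.

(** * The pairing expressed through Theta, and triangularity *)

Section Pairing.
Variable K : fieldType.
Implicit Types (x y : Ho K) (n : nat).

Lemma mcoeff_Theta x s :
  (Theta x)@_s = \sum_(F <- msupp x) x@_F * (Theta << F >>)@_s.
Proof. by rewrite raddf_sum; apply: eq_bigr => F _; rewrite /= mcoeffZ ThetaU. Qed.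

Lemma mcoeff_ThetaU n (F : oforest_of n) (s : 'S_n) :
  (Theta << (Tagged oforest_of F : oforest) >> : FQSym K)@_(Tagged (fun n => 'S_n) s)
    = (s \in S_ F)%:R.
Proof.
rewrite ThetaU raddf_sum /=; under eq_bigr do rewrite mcoeffU eq_Tagged /=.
case sF: (s \in S_ F).
  by rewrite (bigD1 s) //= eqxx big1 ?addr0 // => t /andP[_ /negPf->].
by rewrite big1 // => t tF; case: eqP tF => [->|//]; rewrite sF.
Qed.

Lemma mcoeff_ThetaU_neq (F : oforest) (s : permutation) :
  tag F != tag s -> (Theta << F >> : FQSym K)@_s = 0.
Proof.
move=> neFs; rewrite ThetaU raddf_sum /= big1 // => t _.
by rewrite mcoeffU (_ : (_ == s) = false) //; apply: contraNF neFs => /eqP<-.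
Qed.

Lemma pairing_Theta x (G : oforest) :
  pairing x << G >>
    = \sum_(t in S_ (tagged G)) (Theta x)@_(Tagged (fun n => 'S_n) (t^-1)%g).
Proof.
under [RHS]eq_bigr do rewrite mcoeff_Theta.
rewrite exchange_big /=; apply: eq_bigr => F _.
rewrite linextU -mulr_sumr; congr (_ * _).
have [eqFG|neFG] := eqVneq (tag F) (tag G); last first.
  by rewrite Spair_neq // cards0 big1 // => t _; apply: mcoeff_ThetaU_neq.
case: F G eqFG => [n F] [m G] /= eqnm; case: _ / eqnm G => G.
under eq_bigr do rewrite mcoeff_ThetaU.
rewrite card_Spair -sum1_card natr_sum big_mkcond [RHS]big_mkcond.
by apply: eq_bigr => t _; rewrite inE; do 2!case: (_ \in _).
Qed.

Lemma pairingC x y : pairing x y = pairing y x.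
Proof.
rewrite /pairing /linext; under eq_bigr do rewrite scaler_sumr.
rewrite exchange_big; apply: eq_bigr => G _; rewrite scaler_sumr.
by apply: eq_bigr => F _; rewrite card_Spair_sym !scalerA mulrC.
Qed.

Lemma pairing_sumr x y : pairing x y = \sum_(G <- msupp y) y@_G * pairing x << G >>.
Proof.
by rewrite pairingC; apply: eq_bigr => G _; rewrite pairingC /pairing linextU.
Qed.

(* [left_forest_min] makes this linear system unitriangular. *)
Lemma sum_S_left_forest_eq0 n (g : 'S_n -> K) :
  (forall s, \sum_(t in S_ (left_forest s)) g t = 0) -> forall s, g s = 0.
Proof.
move=> sum0 s0; apply/eqP; apply: contraT => gs0.
(* Take [s] of greatest code with [g s] nonzero: the other terms of its equation have larger codes,
   hence vanish. *)
have [s gs smax] := @Order.TotalTheory.arg_maxP _ _ _ s0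
  (fun s => g s != 0) (@before_code n) gs0.
have := sum0 s; rewrite (bigD1 s) ?left_forest_self //=.
rewrite big1 ?addr0 => [/eqP|t /andP[tF nts]].
  by rewrite (negPf gs).
apply/eqP; apply: contraT => /smax /=; rewrite leNgt.
by rewrite left_forest_min.
Qed.

(** Testing against heap-ordered forests alone lets this serve both the kernel and the
    non-degeneracy. *)
Lemma pairing_heap_Theta0 x :
    (forall F, heap_ordered F -> pairing x << F >> = 0) -> Theta x = 0.
Proof.
move=> x0; apply/malgP=> -[n s]; rewrite mcoeff0.
pose g (t : 'S_n) := (Theta x)@_(Tagged (fun n => 'S_n) (t^-1)%g).
suff <- : g (s^-1)%g = 0 by rewrite /g invgK.
apply: sum_S_left_forest_eq0 => t.
rewrite -(pairing_Theta x (Tagged oforest_of (left_forest t))) x0 //.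
exact: left_forest_heap.
Qed.

Lemma in_Hho_U (F : oforest) : heap_ordered F -> in_Hho (<< F >> : Ho K).
Proof.
by move=> hoF; exists [:: F], (fun=> 1); rewrite /= hoF big_seq1 scale1r.
Qed.

Lemma in_Hho_msupp x : in_Hho x -> {in msupp x, forall F, heap_ordered F}.
Proof.
case=> r [c [/allP r_ho ->]] F; rewrite -mcoeff_neq0 raddf_sum /=.
apply: contraR => nhoF; apply/eqP; rewrite big_seq big1 // => G /r_ho hoG.
rewrite mcoeffZ mcoeffU; case: eqP hoG nhoF => [-> ->//|_ _ _].
by rewrite mulr0.
Qed.

(** The triangularity is now read on the other index: for [s] of least code among the forests in the
    support of [x], only [left_forest s] contributes to the coefficient of [s] in Theta(x). *)
Lemma Theta_Hho_inj x : in_Hho x -> Theta x = 0 -> x = 0.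
Proof.
move=> /in_Hho_msupp x_ho Tx0; apply/malgP=> -[n F0]; rewrite mcoeff0.
apply/eqP; apply: contraT => xF0.
have := xF0; rewrite mcoeff_neq0 => /x_ho/left_forest_surj[/= s0 eF0].
pose f s := Tagged oforest_of (left_forest s) : oforest.
have xs0 : x@_(f n s0) != 0 by rewrite /f -eF0.
have [s xs smin] := @Order.TotalTheory.arg_minP _ _ _ s0
  (fun s => x@_(f n s) != 0) (@before_code n) xs0.
have := congr1 (mcoeff (Tagged (fun n => 'S_n) s)) Tx0.
rewrite mcoeff0 mcoeff_Theta (big_fsetD1 (f n s)) /= -?mcoeff_neq0 //.
rewrite mcoeff_ThetaU left_forest_self mulr1.
rewrite big_seq big1 ?addr0 => [/eqP|F]; first by rewrite (negPf xs).
rewrite in_fsetD1 => /andP[neF xF].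
have hoF := x_ho F xF; rewrite -mcoeff_neq0 in xF.
have [eqFn|neFn] := eqVneq (tag F) n; last by rewrite mcoeff_ThetaU_neq ?mulr0.
case: F eqFn hoF xF neF => m F /= eqmn; case: _ / (esym eqmn) F => F.
case/left_forest_surj=> t /= -> /smin le_st neF; rewrite mcoeff_ThetaU.
case sF: (s \in _); last by rewrite mulr0.
(* A contribution of [left_forest t] would give [t] a smaller code than [s]. *)
have /(left_forest_min sF) : s != t by apply: contraNneq neF => ->.
by rewrite ltNge le_st.
Qed.

End Pairing.

Theorem corollary12 (K : fieldType) :
  (forall x : Ho K, (forall y : Ho K, pairing x y = 0) <-> Theta x = 0) /\
  nondegenerate_on (@in_Hho K) (@pairing K).
Proof.
have nondeg (x : Ho K) : in_Hho x -> (forall y, in_Hho y -> pairing x y = 0) -> x = 0.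
  move=> x_ho x0; apply: Theta_Hho_inj x_ho (pairing_heap_Theta0 _) => F hoF.
  exact/x0/in_Hho_U.
split=> [x|]; last first.
  split=> // y y_ho y0; apply: nondeg y_ho _ => x /y0 <-; apply: pairingC.
split=> [x0 | Tx0 y]; first by apply: pairing_heap_Theta0 => F _; apply: x0.
rewrite pairing_sumr big1 // => G _.
by rewrite pairing_Theta Tx0 big1 ?mulr0 // => t _; rewrite mcoeff0.
Qed.
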